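(* Let $p>1$, let $\alpha\in(0,1]$, and let $c\colon\mathbb{R}^d\to\mathbb{R}$ be a convex function with $c\in C^{2,\alpha}(\mathbb{R}^d\setminus\{0\})\cap C^1(\mathbb{R}^d)$, $c(0)=0$, $\nabla c(0)=0$, and such that for some $\Lambda>0$ and all $x,y\in\mathbb{R}^d$, $$\Lambda^{-1}(|x|+|y|)^{p-2}|x-y|^2\le\langle\nabla c(x)-\nabla c(y),x-y\rangle,$$ $$|\nabla c(x)-\nabla c(y)|\le\Lambda(|x|+|y|)^{p-2}|x-y|.$$ Let $\pi=(x,T(x))_{\#}\rho_0$ be a minimiser of the $c$-optimal transport problem $$\min_{\pi\in\Pi(\rho_0,\rho_1)}\int c(x-y)\,\mathrm{d}\pi(x,y)$$ between $\rho_0$ and $\rho_1$. Given $A\in\mathbb{R}^{d\times d}$, $b\in\mathbb{R}^d$ and $m>0$, set $$E_m=\int_{B_2}|T(x)-x-b-Ax|^m\,\mathrm{d}\rho_0,\qquad D=\inf_{B_r\Subset B_2}\frac{\rho_0(B_r)}{r^d}.$$ Assume $D>0$. Then there is a constant $C$, depending only on $D$, $p$, $m$, $d$, $|A|$ and $\Lambda$ (in particular not on $b$), such that for ($\rho_0$-almost every) $x\in B_{1/2}$, $$|T(x)-x-b-Ax|\le C\begin{cases}E_m^{\frac1m}&\text{if }E_m\ge1,\\[2pt] E_m^{\frac1{m+d}}&\text{if }E_m\le1.\end{cases}$$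
   Context: $\rho_0,\rho_1$ are positive measures on $\mathbb{R}^d$ (or densities, identified with the corresponding measures) of the same finite total mass. $\Pi(\rho_0,\rho_1)$ is the set of (positive) measures on $\mathbb{R}^d\times\mathbb{R}^d$ with first marginal $\rho_0$ and second marginal $\rho_1$. The minimum in the optimal transport problem is understood to be finite. The minimiser is of Monge form, i.e. $\pi=(x,T(x))_{\#}\rho_0$ (push-forward of $\rho_0$ under $x\mapsto(x,T(x))$) for a map $T\colon\mathbb{R}^d\to\mathbb{R}^d$, determined $\rho_0$-a.e. $B_2$ and $B_{1/2}$ are the balls of radius $2$ and $1/2$ centred at the origin; the infimum in $D$ is over all balls $B_r$ of radius $r>0$ and arbitrary centre that are compactly contained in $B_2$. $|A|$ is a norm of the matrix $A$. *)

(* Defs.v *)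
From HB Require Import structures.
From mathcomp Require Import all_boot all_order all_algebra.
From mathcomp Require Import all_classical all_reals all_analysis.

Set Implicit Arguments.
Unset Strict Implicit.
Unset Printing Implicit Defensive.

Import Order.TTheory GRing.Theory Num.Theory.
Import numFieldNormedType.Exports.

Local Open Scope classical_set_scope.
Local Open Scope ring_scope.

(* Points of R^d are row vectors, so the matrix-vector product A x is written
   x *m A^T.  The library norm on matrices is the sup norm; it is used below
   only through the topology it induces. *)

(* R^d with its Borel sigma-algebra. *)
Notation borelRd R d := (g_sigma_algebraType (@open 'rV[R]_d)).

Section euclidean_space.
Variable R : realType.

Definition inner (d : nat) (u v : 'rV[R]_d) : R := \sum_(i < d) u 0 i * v 0 i.

(* The Euclidean norm of a row vector when k = 1, the Frobenius norm of a
   square matrix when k = l. *)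
Definition enorm (k l : nat) (M : 'M[R]_(k, l)) : R :=
  Num.sqrt (\sum_(i < k) \sum_(j < l) M i j ^+ 2).

Definition eball (d : nat) (a : 'rV[R]_d) (r : R) : set 'rV[R]_d :=
  [set x | enorm (x - a) < r].

Definition compactly_contained (d : nat) (A B : set 'rV[R]_d) : Prop :=
  compact (closure A) /\ closure A `<=` B.

End euclidean_space.

Section regularity.
Variables (R : realType) (d : nat).
Implicit Types (c : 'rV[R]_d -> R) (U K : set 'rV[R]_d).

Definition partial (i : 'I_d) c (x : 'rV[R]_d) : R := 'D_(delta_mx 0 i) c x.

Definition grad c (x : 'rV[R]_d) : 'rV[R]_d := \row_i partial i c x.

Definition hessian c (x : 'rV[R]_d) : 'M[R]_d :=
  \matrix_(i, j) partial j (partial i c) x.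

Definition C1 c : Prop := (forall x, differentiable c x) /\ continuous (grad c).

(* C^{2,alpha}(U) for U open: the Hoelder condition on the second derivatives
   is the local one, i.e. it is uniform on each compact subset of U.  The cost
   |x|^p shows that a global condition on R^d \ {0} would be inappropriate. *)
Definition C2holder (alpha : R) U c : Prop :=
  [/\ forall x, U x -> differentiable c x,
      forall i x, U x -> differentiable (partial i c) x,
      forall x, U x -> {for x, continuous (hessian c)} &
      forall K, compact K -> K `<=` U ->
        exists M : R, forall x y, K x -> K y ->
          enorm (hessian c x - hessian c y) <= M * enorm (x - y) `^ alpha].

(* When p < 2 the weight (|x| + |y|)^(p - 2) is meaningless at x = y = 0; there
   powR gives it a finite value, and both inequalities hold trivially. *)
Definition p_elliptic (p Lambda : R) c : Prop :=
  forall x y : 'rV[R]_d,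
    Lambda^-1 * (enorm x + enorm y) `^ (p - 2) * enorm (x - y) ^+ 2
      <= inner (grad c x - grad c y) (x - y)
    /\ enorm (grad c x - grad c y)
      <= Lambda * (enorm x + enorm y) `^ (p - 2) * enorm (x - y).

End regularity.

Section transport.
Variables (R : realType) (d : nat).
Local Notation X := (borelRd R d).
Implicit Types (rho : {finite_measure set X -> \bar R})
  (pi : {measure set (X * X) -> \bar R}) (c : 'rV[R]_d -> R).

Definition coupling rho0 rho1 pi : Prop :=
  forall S : set X, measurable S ->
    pi (S `*` [set: X]) = rho0 S /\ pi ([set: X] `*` S) = rho1 S.

Definition transport_cost c pi : \bar R :=
  (\int[pi]_z (c ((z.1 : 'rV[R]_d) - z.2))%:E)%E.

(* The minimal cost is required to be finite. *)
Definition optimal_plan c rho0 rho1 pi : Prop :=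
  [/\ coupling rho0 rho1 pi,
      transport_cost c pi \is a fin_num &
      forall pi' : {measure set (X * X) -> \bar R},
        coupling rho0 rho1 pi' ->
        (transport_cost c pi <= transport_cost c pi')%E].

Definition monge_form rho0 pi (T : 'rV[R]_d -> 'rV[R]_d) : Prop :=
  measurable_fun [set: X] (T : X -> X) /\
  forall S : set (X * X), measurable S ->
    pi S = pushforward rho0 (fun x : X => (x, T x) : X * X) S.

(* It may be infinite. *)
Definition excess (m : R) rho0 (T : 'rV[R]_d -> 'rV[R]_d)
    (A : 'M[R]_d) (b : 'rV[R]_d) : \bar R :=
  (\int[rho0]_(x in (eball 0 2 : set X))
     (enorm (T x - x - b - (x : 'rV[R]_d) *m A^T) `^ m)%:E)%E.

Definition lower_density rho0 : \bar R :=
  ereal_inf [set v | exists (a : 'rV[R]_d) (r : R),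
    [/\ 0 < r, compactly_contained (eball a r) (eball 0 2) &
        v = (rho0 (eball a r : set X) * ((r ^+ d)^-1)%:E)%E]].

End transport.

(* Main.v *)
Require Import Defs.
From HB Require Import structures.
From mathcomp Require Import all_boot all_order all_algebra.
From mathcomp Require Import all_classical all_reals all_analysis.
From mathcomp Require Import measurable_realfun ring lra.
Import Order.TTheory GRing.Theory Num.Theory.
Import numFieldNormedType.Exports.
Local Open Scope classical_set_scope.
Local Open Scope ring_scope.

(** Swapping the targets of [x] and [y] on the set of pairs where this lowers
    the cost is a competitor: it is the normalised image of rho0 x rho0 under
    (x, y) |-> (x, T y) on that symmetric set and (x, y) |-> (x, T x) off it.
    By optimality the set is null, so almost all pairs satisfy
    c(x - T x) + c(y - T y) <= c(x - T y) + c(y - T x).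

    By the mean value theorem such a pair yields P, Q with
    P - Q = u(y) - u(x) + (1 + A)(y - x), where u(x) = T x - x - b - A x, and
    <grad c P - grad c Q, y - x> >= 0.  The two ellipticity bounds carry the
    same weight (|P| + |Q|)^(p - 2), so grad c P - grad c Q makes an angle with
    P - Q that is bounded in terms of Lambda alone.  For y in a ball of radius
    comparable to r around x + r u(x)/|u(x)| this forces
    |u(x)| <= K |u(y)| + B r.  Averaging over the ball, whose mass is at least
    a multiple of r^d, and taking r = min(1, E^(1/(m + d)))/2 concludes (any
    small r if E = 0). *)

Set Implicit Arguments.
Unset Strict Implicit.
Unset Printing Implicit Defensive.

(** * The Euclidean inner product and norm on row vectors *)

Section euclidean.
Variables (R : realType) (d : nat).
Implicit Types (u v w : 'rV[R]_d) (A : 'M[R]_d).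

Lemma innerC u v : inner u v = inner v u.
Proof. by apply: eq_bigr => i _; rewrite mulrC. Qed.

Lemma innerDl u v w : inner (u + v) w = inner u w + inner v w.
Proof. by rewrite -big_split/=; apply: eq_bigr => i _; rewrite mxE mulrDl. Qed.

Lemma innerZl k u v : inner (k *: u) v = k * inner u v.
Proof. by rewrite mulr_sumr; apply: eq_bigr => i _; rewrite mxE mulrA. Qed.

Lemma innerBl u v w : inner (u - v) w = inner u w - inner v w.
Proof. by rewrite -scaleN1r innerDl innerZl mulN1r. Qed.

Lemma innerDr u v w : inner w (u + v) = inner w u + inner w v.
Proof. by rewrite innerC innerDl !(innerC w). Qed.

Lemma innerZr k u v : inner u (k *: v) = k * inner u v.
Proof. by rewrite innerC innerZl innerC. Qed.

Lemma inner_ge0 u : 0 <= inner u u.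
Proof. by apply: sumr_ge0 => i _; rewrite -expr2 sqr_ge0. Qed.

Lemma enormE u : enorm u = Num.sqrt (inner u u).
Proof.
by rewrite /enorm big_ord1; congr Num.sqrt; apply: eq_bigr => i _; rewrite expr2.
Qed.

Lemma sqr_enorm u : enorm u ^+ 2 = inner u u.
Proof. by rewrite enormE sqr_sqrtr// inner_ge0. Qed.

Lemma enorm_ge0 k l (M : 'M[R]_(k, l)) : 0 <= enorm M.
Proof. exact: sqrtr_ge0. Qed.

Lemma inner0l u : inner 0 u = 0.
Proof. by apply: big1 => i _; rewrite mxE mul0r. Qed.

Lemma enorm0 : enorm (0 : 'rV[R]_d) = 0.
Proof. by rewrite enormE inner0l sqrtr0. Qed.

Lemma enorm_eq0 u : (enorm u == 0) = (u == 0).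
Proof.
apply/idP/eqP => [|->]; last by rewrite enorm0.
rewrite enormE sqrtr_eq0 => u0; have /eqP : inner u u = 0.
  by apply/eqP; rewrite eq_le u0 inner_ge0.
rewrite psumr_eq0 => [/allP uu|i _]; last by rewrite -expr2 sqr_ge0.
apply/rowP => i; rewrite mxE; apply/eqP.
by have := uu i (mem_index_enum _); rewrite mulf_eq0 orbb.
Qed.

Lemma enorm_gt0 u : (0 < enorm u) = (u != 0).
Proof. by rewrite lt_def enorm_eq0 enorm_ge0 andbT. Qed.

(** Expand the nonnegative square of [enorm v *: u - enorm u *: v] and cancel the product of the
    norms, zero vectors being treated apart. *)
Lemma inner_le_enorm u v : inner u v <= enorm u * enorm v.
Proof.
have [->|u0] := eqVneq u 0; first by rewrite inner0l enorm0 mul0r.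
have [->|v0] := eqVneq v 0; first by rewrite innerC inner0l enorm0 mulr0.
have uv_gt0 : 0 < enorm u * enorm v by rewrite mulr_gt0// enorm_gt0.
have := inner_ge0 (enorm v *: u - enorm u *: v).
rewrite innerBl !innerZl [inner u _]innerC [inner v _]innerC !innerBl !innerZl.
rewrite (innerC v u) -!sqr_enorm => h.
by rewrite -(ler_pM2l uv_gt0); nra.
Qed.

Lemma ler_enormD u v : enorm (u + v) <= enorm u + enorm v.
Proof.
rewrite -(@ler_pXn2r _ 2%N)// ?nnegrE ?addr_ge0 ?enorm_ge0//.
rewrite sqr_enorm innerDl !innerDr (innerC v) -!sqr_enorm.
by have := inner_le_enorm u v; nra.
Qed.

Lemma enormZ k u : enorm (k *: u) = `|k| * enorm u.
Proof.
rewrite !enormE innerZl innerZr mulrA -expr2 sqrtrM ?sqr_ge0//.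
by rewrite sqrtr_sqr.
Qed.

Lemma enormN u : enorm (- u) = enorm u.
Proof. by rewrite -scaleN1r enormZ normrN1 mul1r. Qed.

Lemma ler_enormB u v : enorm u - enorm v <= enorm (u - v).
Proof. by rewrite lerBlDr -{1}(subrK v u) ler_enormD. Qed.

Lemma sqr_inner_le u v : inner u v ^+ 2 <= (enorm u * enorm v) ^+ 2.
Proof.
have := inner_le_enorm u v; have := inner_le_enorm (- u) v.
rewrite enormN -scaleN1r innerZl mulN1r => h1 h2.
rewrite -subr_ge0 subr_sqr mulr_ge0//; lra.
Qed.

(** Cauchy-Schwarz for each row of [A], summed over the rows. *)
Lemma enorm_mulmxT A u : enorm (u *m A^T) <= enorm A * enorm u.
Proof.
rewrite -(@ler_pXn2r _ 2%N)// ?nnegrE ?mulr_ge0 ?enorm_ge0//.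
rewrite exprMn sqr_enorm {2}/enorm sqr_sqrtr; last first.
  by do 2!apply: sumr_ge0 => ? _; rewrite sqr_ge0.
rewrite mulr_suml; apply: ler_sum => i _.
have -> : (u *m A^T) 0 i = inner (row i A) u.
  by rewrite !mxE; apply: eq_bigr => j _; rewrite !mxE mulrC.
have -> : \sum_(j < d) A i j ^+ 2 = inner (row i A) (row i A).
  by apply: eq_bigr => j _; rewrite !mxE expr2.
by rewrite -sqr_enorm -exprMn -expr2 sqr_inner_le.
Qed.

End euclidean.

(** * From the two-point inequality to a displacement bound *)

Section monotone_displacement.
Variables (R : realType) (d : nat).
Implicit Types (c : 'rV[R]_d -> R) (a h u v w x y P Q : 'rV[R]_d).

Lemma derive_inner_grad c x h : differentiable c x ->
  'D_h c x = inner (grad c x) h.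
Proof.
move=> dc; rewrite deriveE// {1}(row_sum_delta h) linear_sum.
by apply: eq_bigr => i _; rewrite linearZ mxE /partial deriveE// mulrC.
Qed.

Lemma is_derive_line c a h (t : R) : differentiable c (a + t *: h) ->
  is_derive t 1 (fun s => c (a + s *: h)) (inner (grad c (a + t *: h)) h).
Proof.
move=> dc; have := derivableP (diff_derivable (v := h) dc).
rewrite derive_inner_grad// => -[].
rewrite /derivable /derive.
set q1 := (fun s : R => _) => dr lc.
suff q12 : q1 = fun s : R => s^-1 *: (c (a + (s *: 1 + t) *: h) - c (a + t *: h)).
  by split; [move: dr|move: lc]; rewrite q12.
apply/funext => s; congr (_ *: (c _ - _)).
by rewrite scalerDl [s *: 1]mulr1 addrCA.
Qed.

(** The mean value theorem on the segment from the origin to [x] reduces this to ellipticity tested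
    against the origin. Nonnegativity of the cost is what later opens the way to Tonelli's
    theorem. *)
Lemma p_elliptic_ge0 c p Lambda : 0 < Lambda -> (forall x, differentiable c x) ->
  c 0 = 0 -> grad c 0 = 0 -> p_elliptic p Lambda c -> forall x, 0 <= c x.
Proof.
move=> L0 dc c0 g0 ell x.
have dl (t : R) := is_derive_line (dc (0 + t *: x)).
have ccont : {within `[0 : R, 1], continuous (fun s => c (0 + s *: x))}.
  apply: derivable_within_continuous => t _.
  by apply: ex_derive; exact: dl.
have [t t01] := MVT ltr01 (fun t _ => dl t) ccont.
rewrite scale0r scale1r !add0r c0 !subr0 mulr1 => ->.
move: t01; rewrite in_itv/= => /andP[t0 _].
rewrite -(pmulr_rge0 _ t0) -innerZr.
have [+ _] := ell (t *: x) 0; rewrite g0 !subr0; apply: le_trans.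
by rewrite mulr_ge0 ?sqr_ge0// mulr_ge0 ?powR_ge0// invr_ge0 ltW.
Qed.

Lemma two_point_grad_monotone c a a' h : (forall x, differentiable c x) ->
  c a + c a' <= c (a + h) + c (a' - h) ->
  exists P Q, P - Q = a - a' + h /\ 0 <= inner (grad c P - grad c Q) h.
Proof.
move=> dc le2.
have dl b (t : R) := is_derive_line (dc (b + t *: h)).
(* The increment of [g] over [[0, 1]] is the right side of the hypothesis minus the left, and the
   two arguments of [c] keep the constant difference [a - a' + h]. *)
pose g (s : R) := c (a + s *: h) - c ((a' - h) + s *: h).
have dg (t : R) : is_derive t 1 g (inner (grad c (a + t *: h) - grad c (a' - h + t *: h)) h).
  by rewrite innerBl; apply: is_deriveB; exact: dl.
have gcont : {within `[0 : R, 1], continuous g}.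
  apply: derivable_within_continuous => t _.
  by apply: ex_derive; exact: dg.
have [t _] := MVT ltr01 (fun t _ => dg t) gcont.
rewrite /g !scale1r !scale0r !addr0 subrK subr0 mulr1 => gE.
exists (a + t *: h), (a' - h + t *: h); split; last by rewrite -gE; lra.
by rewrite opprD addrACA subrr addr0 opprB addrA addrAC.
Qed.

(** Inserting the upper bound into the lower one removes the common weight without dividing by it,
    so a vanishing weight does no harm. *)
Lemma p_elliptic_cone c p Lambda P Q : 0 < Lambda -> p_elliptic p Lambda c ->
  Lambda ^- 2 * (enorm (grad c P - grad c Q) * enorm (P - Q))
    <= inner (grad c P - grad c Q) (P - Q).
Proof.
move=> L0 ell; have [+ +] := ell P Q.
set W := _ `^ _; have W0 : 0 <= W by exact: powR_ge0.
have N0 := enorm_ge0 (P - Q).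
move=> le1 le2; apply: le_trans le1.
apply: (@le_trans _ _ (Lambda ^- 2 * (Lambda * W * enorm (P - Q) * enorm (P - Q)))).
  by apply: ler_wpM2l; [rewrite invr_ge0 exprn_ge0 ?ltW|exact: ler_wpM2r].
rewrite le_eqVlt; apply/orP; left; apply/eqP; field.
by rewrite gt_eqF.
Qed.

(** For distinct points [enorm P + enorm Q] is positive, hence so is the weight, whatever [p] is.
    This settles the case of a zero gradient difference, where the cone bound is void. *)
Lemma p_elliptic_inj c p Lambda P Q : 0 < Lambda -> p_elliptic p Lambda c ->
  grad c P = grad c Q -> P = Q.
Proof.
move=> L0 ell PQ; apply/eqP; rewrite -subr_eq0; apply/negP => /negP PQ0.
have [+ _] := ell P Q; rewrite PQ subrr inner0l; apply/negP; rewrite -ltNge.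
have n0 : 0 < enorm (P - Q) by rewrite enorm_gt0.
rewrite !mulr_gt0 ?invr_gt0 ?exprn_gt0// powR_gt0//.
apply: lt_le_trans n0 _; rewrite -(enormN Q); exact: ler_enormD.
Qed.

(* [V] makes a uniformly acute angle with [P - Q], which is nearly [U]; hence
   [V] cannot have a nonnegative product with a vector in a narrow cone
   around [- U] unless the error [w] is comparable to [U]. *)
Lemma cone_displacement (V PQ U w e : 'rV[R]_d) (k del r : R) :
  0 < k -> 0 < del -> del <= k / 2 -> 0 < r ->
  PQ = U + w -> (V = 0 -> PQ = 0) ->
  k * (enorm V * enorm PQ) <= inner V PQ -> U != 0 -> enorm e <= del * r ->
  0 <= inner V (e - (r / enorm U) *: U) ->
  enorm U <= 2 * (1 + k) / k * enorm w.
Proof.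
move=> k0 del0 delk r0 PQE VPQ cone U0 er le0.
have w0 := enorm_ge0 w.
have n0 : 0 < enorm U by rewrite enorm_gt0.
suff : k / 2 * enorm U <= (1 + k) * enorm w.
  by move=> H; rewrite -(ler_pM2l (divr_gt0 k0 (ltr0Sn R 1))) (le_trans H)//
    le_eqVlt; apply/orP; left; apply/eqP; field; rewrite gt_eqF.
have [V0|V0] := eqVneq V 0.
  have : U = - w by apply/eqP; rewrite -addr_eq0 -PQE VPQ.
  by move=> ->; rewrite enormN ler_wpM2r//; lra.
have v0 : 0 < enorm V by rewrite enorm_gt0.
(* Cauchy-Schwarz on [inner V e], then division by [r / enorm U]. *)
have : inner V U <= enorm V * del * enorm U.
  move: le0; rewrite innerDr -scaleNr innerZr mulNr subr_ge0.
  move=> /le_trans -/(_ _ (inner_le_enorm _ _)).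
  rewrite mulrAC ler_pdivrMr// => h.
  rewrite -(ler_pM2l r0); apply: (le_trans h).
  have := ler_wpM2l (ltW (mulr_gt0 v0 n0)) er; nra.
have VPQE : inner V PQ = inner V U + inner V w by rewrite PQE innerDr.
have Vw := inner_le_enorm V w.
have Un : enorm U - enorm w <= enorm PQ.
  by rewrite PQE -{2}(opprK w) -(enormN w) ler_enormB.
move=> VU.
(* Together with [Un] this gives [(k - del) * enorm U <= (1 + k) * enorm w], and [del <= k / 2]
   produces the constant. *)
have : k * enorm PQ <= del * enorm U + enorm w.
  by rewrite -(ler_pM2l v0); rewrite VPQE in cone; nra.
nra.
Qed.

(** This is [cone_displacement] with [U := - u]. The difference of the displacements at [x] and [y]
    no longer contains [b]; the remaining linear part is controlled by the step [y - x], of length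
    at most [(1 + del) * r]. *)
Lemma displacement_le c p Lambda (A : 'M[R]_d) (b x y Tx Ty e : 'rV[R]_d)
    (del r : R) :
  let u := Tx - x - b - x *m A^T in
  let v := Ty - y - b - y *m A^T in
  let k := Lambda ^- 2 in
  0 < Lambda -> (forall z, differentiable c z) -> p_elliptic p Lambda c ->
  c (x - Tx) + c (y - Ty) <= c (x - Ty) + c (y - Tx) ->
  0 < del -> del <= k / 2 -> 0 < r -> u != 0 ->
  y = x + (r / enorm u) *: u + e -> enorm e <= del * r ->
  enorm u <= 2 * (1 + k) / k * (enorm v + (1 + enorm A) * ((1 + del) * r)).
Proof.
move=> u v k L0 dc ell le2 del0 delk r0 u0 yE er.
have k0 : 0 < k by rewrite invr_gt0 exprn_gt0.
have un0 : 0 < enorm u by rewrite enorm_gt0.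
pose h := y - x.
have hE : h = e - (r / enorm (- u)) *: (- u).
  by rewrite /h yE enormN scalerN opprK addrC addrA addKr addrC.
have [|P [Q [PQE PQh]]] := @two_point_grad_monotone c (x - Tx) (y - Ty) h dc.
  suff [-> ->] : x - Tx + h = y - Tx /\ y - Ty - h = x - Ty.
    by rewrite [leRHS]addrC.
  by split; apply/rowP => i; rewrite !mxE; ring.
pose w := v + h + h *m A^T.
have wE : P - Q = - u + w.
  rewrite PQE /w /u /v /h mulmxBl; move: (x *m A^T) (y *m A^T) => Ax Ay.
  by apply/rowP => i; rewrite !mxE; ring.
have hr : enorm h <= (1 + del) * r.
  rewrite hE -scalerN opprK; apply: le_trans (ler_enormD _ _) _.
  rewrite enormN enormZ ger0_norm; last by rewrite ltW ?divr_gt0.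
  by rewrite divfK ?gt_eqF//; lra.
have wr : enorm w <= enorm v + (1 + enorm A) * ((1 + del) * r).
  apply: le_trans (ler_enormD _ _) _.
  apply: (@le_trans _ _ (enorm v + enorm h + enorm A * enorm h)).
    by rewrite lerD ?ler_enormD ?enorm_mulmxT.
  by rewrite -addrA lerD2l -{1}(mul1r (enorm h)) -mulrDl ler_wpM2l ?addr_ge0 ?enorm_ge0.
apply: (@le_trans _ _ (2 * (1 + k) / k * enorm w)).
  rewrite -(enormN u).
  apply: (@cone_displacement (grad c P - grad c Q) (P - Q) (- u) w e k del r) => //.
  - by move/eqP; rewrite subr_eq0 => /eqP/(p_elliptic_inj L0 ell) ->; rewrite subrr.
  - exact: p_elliptic_cone L0 ell.
  - by rewrite oppr_eq0.
  - by rewrite -hE.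
apply: ler_wpM2l wr; apply: divr_ge0 (ltW k0); lra.
Qed.
End monotone_displacement.

(** * Borel measurability and balls in the space of row vectors *)

Section borel_row_vectors.
Variables (R : realType) (d : nat).
Implicit Types (x y : 'rV[R]_d).

Lemma continuous_measurable_rV (g : 'rV[R]_d -> R) : continuous g ->
  measurable_fun [set: borelRd R d] (g : borelRd R d -> R).
Proof.
move=> gc; apply: (measurability _ (RGenOInfty.measurableE R)).
move=> /= _ [_ [a ->]] <-; rewrite setTI; apply: sub_sigma_algebra.
by move: gc => /continuousP; apply; exact: rray_open.
Qed.

Lemma measurable_coord (i : 'I_d) :
  measurable_fun [set: borelRd R d] (fun x : borelRd R d => (x : 'rV[R]_d) 0 i).
Proof. by apply: continuous_measurable_rV => x; exact: coord_continuous. Qed.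

(** An open set is a countable union of cubes with rational centres, and the preimage of a cube is a
    finite intersection of coordinate conditions. *)
Lemma measurable_fun_rV dT (T : measurableType dT) (f : T -> 'rV[R]_d) :
  (forall i, measurable_fun [set: T] (fun z => f z 0 i)) ->
  measurable_fun [set: T] (f : T -> borelRd R d).
Proof.
move=> mf; apply: (measurability _ (erefl : @measurable _ (borelRd R d) = _)).
move=> /= _ [V oV] <-; rewrite setTI.
pose box (qn : 'rV[rat]_d * nat) : set 'rV[R]_d :=
  [set x | forall i, `|x 0 i - ratr (qn.1 0 i)| < qn.2.+1%:R^-1].
pose I := [set qn | box qn `<=` V].
have -> : f @^-1` V = \bigcup_(qn in I) f @^-1` (box qn).
  apply/seteqP; split => [z /= Vfz|z [qn + /=]]; last exact.
  have : nbhs (f z) V by apply: open_nbhs_nbhs.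
  move=> /nbhs_ballP[e /= e0 eV].
  (* Two steps of size [1 / (n + 1)] must fit into [e]: from [f z] to the rational centre, and from
     there to any point of the cube. *)
  pose n := Num.truncn (2 / e).
  have n0 : 0 < n.+1%:R^-1 :> R by rewrite invr_gt0.
  have en : n.+1%:R^-1 + n.+1%:R^-1 < e.
    rewrite -mulr2n -[X in X < _]mulr_natl -ltr_pdivlMl//.
    rewrite -[ltRHS]invrK ltf_pV2 ?posrE// ?invr_gt0 ?mulr_gt0//.
    by rewrite invfM invrK truncnS_gt.
  have qP i : exists q : rat, `|f z 0 i - ratr q| < n.+1%:R^-1.
    have [|q] := @rat_in_itvoo R (f z 0 i - n.+1%:R^-1) (f z 0 i + n.+1%:R^-1).
      by rewrite ltrBlDr -addrA ltrDl addr_gt0.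
    rewrite in_itv/= => qI; exists q.
    by rewrite distrC ltr_distl.
  pose q := \row_i projT1 (cid (qP i)).
  have qE i : `|f z 0 i - ratr (q 0 i)| < n.+1%:R^-1 by rewrite mxE; case: cid.
  exists (q, n) => // x /= xq; apply: eV; split=> // i j.
  rewrite ord1 -ball_normE/=; apply: le_lt_trans en.
  rewrite -(subrKA (ratr (q 0 j))); apply: le_trans (ler_normD _ _) _.
  by rewrite lerD ?ltW// distrC xq.
rewrite bigcup_mkcond.
apply: countable_bigcupT_measurable => // qn.
case: ifPn => // _.
have -> : f @^-1` box qn =
    \bigcap_(i in [set: 'I_d]) [set z | `|f z 0 i - ratr (qn.1 0 i)| < qn.2.+1%:R^-1].
  by apply/seteqP; split => [z zq i _|z zq i]; exact: zq.
apply: fin_bigcap_measurable => // i _.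
rewrite -[X in measurable X]setTI; apply: measurable_fun_ltr => //.
by apply: measurableT_comp => //; exact: measurable_funB.
Qed.

Lemma measurable_funB_rV dT (T : measurableType dT) (f g : T -> borelRd R d) :
  measurable_fun [set: T] f -> measurable_fun [set: T] g ->
  measurable_fun [set: T] ((fun z => (f z : 'rV[R]_d) - g z) : T -> borelRd R d).
Proof.
move=> mf mg; apply: measurable_fun_rV => i.
under eq_fun do rewrite !mxE.
by apply: measurable_funB; apply: (measurableT_comp (measurable_coord i)).
Qed.

Lemma enorm_continuous : continuous (fun x : 'rV[R]_d => enorm x).
Proof.
suff sc : continuous (fun x : 'rV[R]_d => \sum_(i < 1) \sum_(j < d) x i j ^+ 2).
  by move=> x; apply: (continuous_comp (sc x)); exact: sqrt_continuous.
do 2!(apply: continuous_big => [|? _]; first exact: add_continuous).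
move=> x; apply: (@continuous_comp _ _ _ _ (fun t : R => t ^+ 2)).
  exact: coord_continuous.
exact: exprn_continuous.
Qed.

Lemma measurable_enorm :
  measurable_fun [set: borelRd R d] (fun x : borelRd R d => enorm (x : 'rV[R]_d)).
Proof. exact: continuous_measurable_rV enorm_continuous. Qed.

Lemma measurable_displacement (T : 'rV[R]_d -> 'rV[R]_d) (A : 'M[R]_d) (b : 'rV[R]_d) :
  measurable_fun [set: borelRd R d] (T : borelRd R d -> borelRd R d) ->
  measurable_fun [set: borelRd R d]
    ((fun x => T x - x - b - x *m A^T) : borelRd R d -> borelRd R d).
Proof.
move=> mT; apply: measurable_funB_rV.
  by apply: measurable_funB_rV => //; exact: measurable_funB_rV.
apply: measurable_fun_rV => i; under eq_fun do rewrite mxE.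
by apply: measurable_sum => j; apply: measurable_funM => //; exact: measurable_coord.
Qed.

Lemma measurable_eball (a : 'rV[R]_d) (r : R) :
  measurable (eball a r : set (borelRd R d)).
Proof.
rewrite -[X in measurable X]setTI; apply: measurable_fun_ltr => //.
by apply: (measurableT_comp measurable_enorm); exact: measurable_funB_rV.
Qed.

Lemma closure_eball_subset (a : 'rV[R]_d) (r : R) :
  closure (eball a r) `<=` [set x | enorm (x - a) <= r].
Proof.
have cl : closed [set x : 'rV[R]_d | enorm (x - a) <= r].
  apply: (@closed_comp _ _ (fun x : 'rV[R]_d => enorm (x - a)) [set t | t <= r]) => [x _|].
    have sc : {for x, continuous (fun y : 'rV[R]_d => y - a)}.
      apply: (@continuousB _ 'rV[R]_d 'rV[R]_d id (cst a)).
        exact: cvg_id.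
      exact: cst_continuous.
    apply: (continuous_comp sc).
    exact: enorm_continuous.
  exact: closed_le.
by rewrite [X in _ `<=` X](closure_id _).1//; apply: closureS => x /ltW.
Qed.

(** Compactness of closed bounded sets is phrased with the sup norm; this transfers Euclidean bounds
    to it. *)
Lemma normr_le_enorm x : `|x| <= enorm x.
Proof.
have [/eqP|] := eqVneq (`|x|) 0; first by move=> /eqP ->; exact: sqrtr_ge0.
move=> /mx_norm_neq0[[i j]/= xE]; rewrite [leLHS]xE.
rewrite -sqrtr_sqr ler_sqrt; last by do 2!apply: sumr_ge0 => ? _; rewrite sqr_ge0.
rewrite (bigD1 i)//= (bigD1 j)//= -addrA lerDl.
by rewrite addr_ge0 ?sumr_ge0// => *; rewrite ?sumr_ge0// => *; rewrite sqr_ge0.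
Qed.

Lemma compactly_contained_eball (a : 'rV[R]_d) (r s : R) :
  enorm a + r < s -> compactly_contained (eball a r) (eball 0 s).
Proof.
move=> ars.
have clb x : closure (eball a r) x -> enorm x <= enorm a + r.
  move=> /closure_eball_subset/= xa.
  by rewrite -(subrK a x) (le_trans (ler_enormD _ _))// addrC lerD2l.
split.
  apply: bounded_closed_compact; last exact: closed_closure.
  exists (enorm a + r); split; first exact: num_real.
  move=> M KM x /clb xle; apply: le_trans (normr_le_enorm x) _.
  exact: le_trans xle (ltW KM).
by move=> x /clb xle; rewrite /eball/= subr0; exact: le_lt_trans ars.
Qed.

End borel_row_vectors.

(** * The exchange argument for optimal maps *)

Section exchange.
Local Open Scope ereal_scope.
Context dX dY (X : measurableType dX) (Y : measurableType dY) (R : realType).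
Variable mu : {finite_measure set X -> \bar R}.

Lemma measurable_fun_swap dZ (Z : measurableType dZ) (h : X * X -> Z) :
  measurable_fun setT h -> measurable_fun setT (fun z : X * X => h (z.2, z.1)).
Proof.
move=> mh; apply: (measurableT_comp mh).
exact: measurable_fun_pair measurable_snd measurable_fst.
Qed.

Lemma ge0_integral_swap (h : X * X -> \bar R) :
  measurable_fun setT h -> (forall z, 0 <= h z) ->
  \int[mu \x mu]_z h (z.2, z.1) = \int[mu \x mu]_z h z.
Proof.
move=> mh h0; rewrite (fubini_tonelli1 h)// fubini_tonelli2//.
exact: measurable_fun_swap.
Qed.

Lemma ge0_integral_symmetrize (h : X * X -> \bar R) :
  measurable_fun setT h -> (forall z, 0 <= h z) ->
  \int[mu \x mu]_z (h z + h (z.2, z.1)) = 2%:E * \int[mu \x mu]_z h z.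
Proof.
move=> mh h0; rewrite ge0_integralD//; last exact: measurable_fun_swap.
rewrite ge0_integral_swap// -[X in X + _]mul1e -[X in _ + X]mul1e.
by rewrite -ge0_muleDl.
Qed.

Lemma ge0_integral_prod_fst (h : X -> \bar R) :
  measurable_fun setT h -> (forall x, 0 <= h x) ->
  \int[mu \x mu]_z h z.1 = mu setT * \int[mu]_x h x.
Proof.
move=> mh h0; rewrite fubini_tonelli2//; last exact: measurableT_comp.
by rewrite [LHS](_ : _ = \int[mu]_y cst (\int[mu]_x h x) y)// integral_cst// muleC.
Qed.

(** As the integral of [f] is finite, that of [g] can be cancelled, which leaves the nonnegative
    function [f - g] with zero integral. *)
Lemma ge0_integral_le_null d (Z : measurableType d) (nu : {measure set Z -> \bar R})
    (f g : Z -> R) :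
  measurable_fun setT f -> measurable_fun setT g ->
  (forall z, (0 <= g z <= f z)%R) -> \int[nu]_z (f z)%:E < +oo ->
  \int[nu]_z (f z)%:E <= \int[nu]_z (g z)%:E ->
  nu [set z | (g z < f z)%R] = 0.
Proof.
move=> mf mg gf foo fg.
have g0 z : (0 <= g z)%R by case/andP: (gf z).
have fg0 z : (0 <= f z - g z)%R by rewrite subr_ge0; case/andP: (gf z).
have mfg : measurable_fun setT (fun z => (f z - g z)%R) by exact: measurable_funB.
have fE : \int[nu]_z (f z)%:E = \int[nu]_z (f z - g z)%:E + \int[nu]_z (g z)%:E.
  rewrite -ge0_integralD//; do ?exact/measurable_EFinP.
  - by apply: eq_integral => z _; rewrite -EFinD subrK.
  - by move=> z _; rewrite lee_fin.
  - by move=> z _; rewrite lee_fin.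
have gfin : \int[nu]_z (g z)%:E \is a fin_num.
  rewrite ge0_fin_numE; last by apply: integral_ge0 => z _; rewrite lee_fin.
  apply: le_lt_trans foo; rewrite fE leeDr//.
  by apply: integral_ge0 => z _; rewrite lee_fin.
have : \int[nu]_z `|(f z - g z)%:E| = 0.
  under eq_integral do rewrite gee0_abs ?lee_fin//.
  apply/eqP; rewrite eq_le integral_ge0 ?andbT => [|z _]; last by rewrite lee_fin.
  by move: fg; rewrite fE -[leRHS]add0e leeD2rE.
have mv : measurable [set z | (g z < f z)%R].
  by rewrite -[X in measurable X]setTI; exact: measurable_fun_ltr.
move=> /(ae_eq_integral_abs _ measurableT _).1 -/(_ ((measurable_EFinP _ _).2 mfg)).
move=> aefg; apply: measure_negligible => //; apply: negligibleS aefg => z /= gfz.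
move=> /(_ I) [] /eqP; rewrite subr_eq0 => /eqP fgz.
by rewrite fgz ltxx in gfz.
Qed.

(** The product measure of [S] is the integral of the measures of its sections, so almost every
    section is null. *)
Lemma prod_null_ae (S : set (X * X)) : measurable S -> (mu \x mu) S = 0 ->
  {ae mu, forall x, {ae mu, forall y, ~ S (x, y)}}.
Proof.
move=> mS; rewrite /product_measure1 => S0.
have : \int[mu]_x `|(mu \o xsection S) x| = 0.
  by rewrite -[RHS]S0; apply: eq_integral => x _; rewrite gee0_abs.
move=> /(ae_eq_integral_abs _ measurableT _).1 -/(_ (measurable_fun_xsection _ mS)).
apply: filterS => x /(_ I)/= Sx0.
exists (xsection S x); split => //; first exact: measurable_xsection.
by move=> y /= /contrapT Sxy; rewrite /xsection/= inE.
Qed.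

(** The target measure enters as the image of [mu] under [T]. *)
Lemma optimal_map_ae_two_point (k : X * Y -> R) (T : X -> Y) :
  measurable_fun setT k -> (forall z, (0 <= k z)%R) -> measurable_fun setT T ->
  \int[mu]_x (k (x, T x))%:E < +oo ->
  (forall pi : {measure set (X * Y) -> \bar R},
    (forall S, measurable S -> pi (S `*` setT) = mu S) ->
    (forall S, measurable S -> pi (setT `*` S) = mu (T @^-1` S)) ->
    \int[mu]_x (k (x, T x))%:E <= \int[pi]_z (k z)%:E) ->
  {ae mu, forall x, {ae mu, forall y,
    (k (x, T x) + k (y, T y) <= k (x, T y) + k (y, T x))%R}}.
Proof.
move=> mk k0 mT Ioo opt.
pose a (z : X * X) := k (z.1, T z.1).
pose b (z : X * X) := k (z.1, T z.2).
have mfst : measurable_fun setT (fst : X * X -> X) := measurable_fst.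
have msnd : measurable_fun setT (snd : X * X -> X) := measurable_snd.
have mT1 := measurableT_comp mT mfst.
have mT2 := measurableT_comp mT msnd.
have ma : measurable_fun setT a.
  exact: (measurableT_comp mk (measurable_fun_pair mfst mT1)).
have mb : measurable_fun setT b.
  exact: (measurableT_comp mk (measurable_fun_pair mfst mT2)).
pose sw (h : X * X -> R) z := h (z.2, z.1).
have ma' : measurable_fun setT (sw a) := measurable_fun_swap ma.
have mb' : measurable_fun setT (sw b) := measurable_fun_swap mb.
pose v z := (b z + sw b z < a z + sw a z)%R.
have mv : measurable_fun setT v.
  by apply: measurable_fun_ltr; exact: measurable_funD.
pose tgt z := if v z then T z.2 else T z.1.
have mtgt : measurable_fun setT tgt by exact: measurable_fun_ifT.
pose G z := (z.1, tgt z).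
have mG : measurable_fun setT G by exact: measurable_fun_pair.
(* Zero mass makes the claim trivial; otherwise [M] is invertible. The image of the product measure
   under [G] has both marginals too large by the factor [M], hence the scaling by [M^-1]. *)
have [mu0|mu0] := eqVneq (mu setT) 0.
  by exists setT; split.
pose M := fine (mu setT).
have ME : mu setT = M%:E by rewrite fineK// fin_num_measure.
have M0 : (0 < M)%R by rewrite -lte_fin -ME lt_def mu0 measure_ge0.
have Mi0 : (0 <= M^-1)%R by rewrite invr_ge0 ltW.
pose pi0 : {measure set (X * Y) -> \bar R} := pushforward (mu \x mu) G.
pose pi : {measure set (X * Y) -> \bar R} := mscale (NngNum Mi0) (pi0 mG).
have vC z : v (z.2, z.1) = v z.
  by case: z => x y; rewrite /v /sw/= addrC (addrC (a _)).
have MK e : M^-1%:E * (M%:E * e) = e.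
  by rewrite muleA -EFinM mulVf ?gt_eqF// mul1e.
have int_fst (h : X -> R) : measurable_fun setT h -> (forall x, (0 <= h x)%R) ->
    \int[mu \x mu]_z (h z.1)%:E = M%:E * \int[mu]_x (h x)%:E.
  move=> mh h0; rewrite -ME -ge0_integral_prod_fst//.
  exact/measurable_EFinP.
(* The product measure is invariant under the swap, so an integral over pairs depends only on the
   symmetrised integrand. *)
have ge0_symm (h1 h2 : X * X -> R) : measurable_fun setT h1 ->
    measurable_fun setT h2 -> (forall z, (0 <= h1 z)%R) -> (forall z, (0 <= h2 z)%R) ->
    (forall z, h1 z + h1 (z.2, z.1) = h2 z + h2 (z.2, z.1))%R ->
    \int[mu \x mu]_z (h1 z)%:E = \int[mu \x mu]_z (h2 z)%:E.
  move=> mh1 mh2 h10 h20 h12.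
  have : 2%:E * \int[mu \x mu]_z (h1 z)%:E = 2%:E * \int[mu \x mu]_z (h2 z)%:E.
    rewrite -!ge0_integral_symmetrize//; do ?exact/measurable_EFinP.
    by apply: eq_integral => z _; rewrite -!EFinD h12.
  by move=> /(congr1 (fun e => 2^-1%:E * e)); rewrite !muleA -!EFinM mulVf// !mul1e.
have mkG : measurable_fun setT (k \o G) by exact: measurableT_comp.
have : \int[mu]_x (k (x, T x))%:E <= \int[pi]_z (k z)%:E.
  apply: opt => S mS; rewrite /pi /= /mscale/= /pi0/= /pushforward.
    rewrite (_ : G @^-1` _ = S `*` setT); last first.
      by apply/seteqP; split => -[x y] /= [].
    rewrite product_measure1E// muleC -muleA [X in _ * X](_ : _ = 1) ?mule1//.
    transitivity (M%:E * M^-1%:E); first by congr (_ * _); exact: ME.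
    by rewrite -EFinM divff ?gt_eqF.
  (* Second marginal: since [v] is symmetric, the targets of [(x, y)] and [(y, x)] are [T x] and
     [T y] in some order, so the indicator of [S] has the same symmetrisation along [tgt] as along
     [T z.1]. *)
  rewrite (_ : G @^-1` _ = tgt @^-1` S); last first.
    by apply/seteqP; split => -[x y] /= => [[]|].
  have mTS : measurable (T @^-1` S) by rewrite -[X in measurable X]setTI; exact: mT.
  have mtS : measurable (tgt @^-1` S) by rewrite -[X in measurable X]setTI; exact: mtgt.
  rewrite -[in LHS](setIT (tgt @^-1` S)) -integral_indic//.
  rewrite (ge0_symm _ (fun z => \1_(T @^-1` S) z.1)) //.
  - rewrite (int_fst (\1_(T @^-1` S)))// MK integral_indic// setIT//.
  - by apply: measurableT_comp => //.
  - move=> z; rewrite [LHS](_ : _ = \1_S (tgt z) + \1_S (tgt (z.2, z.1)))%R//.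
    rewrite [RHS](_ : _ = \1_S (T z.1) + \1_S (T z.2))%R// /tgt vC.
    by case: ifP => // _; rewrite addrC.
rewrite ge0_integral_mscale//=; do ?[exact/measurable_EFinP|by move=> z _; rewrite lee_fin].
rewrite ge0_integral_pushforward//; do ?[exact/measurable_EFinP|by move=> z _; rewrite lee_fin].
rewrite preimage_setT => le1.
have mkT : measurable_fun setT (fun x => k (x, T x)).
  by apply: (measurableT_comp mk); exact: measurable_fun_pair.
have aE : \int[mu \x mu]_z (a z)%:E = M%:E * \int[mu]_x (k (x, T x))%:E.
  exact: (int_fst (fun x => k (x, T x))).
have le2 : \int[mu \x mu]_z (a z)%:E <= \int[mu \x mu]_z (k (G z))%:E.
  rewrite aE; apply: le_trans (lee_wpmul2l _ le1) _; first by rewrite lee_fin ltW.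
  by rewrite muleA -EFinM divff ?gt_eqF// mul1e.
(* Symmetrised costs before and after the exchange. Pointwise [g <= f], strictly exactly on [v],
   while [le2] orders the integrals the other way. *)
pose f z := (a z + a (z.2, z.1))%R.
pose g z := (k (G z) + k (G (z.2, z.1)))%R.
have gE z : g z = if v z then (b z + sw b z)%R else f z.
  by rewrite /g /G /= /tgt vC; case: ifP.
have mkG' := measurable_fun_swap mkG.
have fE : \int[mu \x mu]_z (f z)%:E = 2%:E * \int[mu \x mu]_z (a z)%:E.
  rewrite -(ge0_integral_symmetrize (h := fun z => (a z)%:E))//.
    exact/measurable_EFinP.
  by move=> z; rewrite lee_fin k0.
have gfE : \int[mu \x mu]_z (g z)%:E = 2%:E * \int[mu \x mu]_z (k (G z))%:E.
  rewrite -(ge0_integral_symmetrize (h := fun z => (k (G z))%:E))//.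
    exact/measurable_EFinP.
  by move=> z; rewrite lee_fin k0.
have vnull : (mu \x mu) [set z | (g z < f z)%R] = 0.
  apply: ge0_integral_le_null.
  - exact: measurable_funD.
  - exact: measurable_funD.
  - move=> z; rewrite {1}/g addr_ge0//= gE; case: ifP => // /ltW; exact.
  - by rewrite fE aE lte_mul_pinfty// lte_mul_pinfty// lee_fin ltW.
  - by rewrite fE gfE lee_wpmul2l.
have vE : [set z | (g z < f z)%R] = [set z | v z].
  by apply/seteqP; split => z /=; rewrite gE; case: ifP => //; rewrite ltxx.
have mvS : measurable [set z | v z] by rewrite -[X in measurable X]setTI; exact: mv.
rewrite vE in vnull.
apply: filterS (prod_null_ae mvS vnull) => x; apply: filterS => y /= /negP.
by rewrite -leNgt.
Qed.

End exchange.

(** * Choice of the radius and the two regimes *)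

Section averaging.
Variable R : realType.

Lemma le_of_powR_le (s K W t m : R) : 0 < m -> 0 <= s -> 0 < K -> 0 <= W ->
  0 <= t -> (s / K) `^ m <= W * t `^ m -> s <= K * W `^ m^-1 * t.
Proof.
move=> m0 s0 K0 W0 t0 h.
have mV0 : 0 <= m^-1 by rewrite invr_ge0 ltW.
have pV z : 0 <= z -> (z `^ m) `^ m^-1 = z.
  by move=> z0; rewrite -powRrM divff ?gt_eqF// powRr1.
have /= := ge0_ler_powR mV0 (powR_ge0 _ _) (mulr_ge0 W0 (powR_ge0 _ _)) h.
rewrite (powRM _ W0) ?powR_ge0// !pV ?divr_ge0 ?(ltW K0)//.
by rewrite ler_pdivrMr// mulrC mulrA.
Qed.

(** At each radius either [s] is already of order [r], or averaging bounds it by [e]. The radius is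
    half of the intended bound, capped at one half, which balances the alternatives. *)
Lemma two_regime_bound (s B K m q e : R) (d : nat) :
  0 < m -> 0 <= s -> 0 < K -> 0 < B -> 0 < q -> 0 <= e ->
  (forall r, 0 < r -> r <= 2^-1 ->
    s <= 2 * B * r \/ (s / K) `^ m * (q * r ^+ d) <= e) ->
  s <= (B + K * (2 ^+ d / q) `^ m^-1) *
    (if 1 <= e then e `^ m^-1 else e `^ (m + d%:R)^-1).
Proof.
move=> m0 s0 K0 B0 q0 e0 h.
set W := 2 ^+ d / q; have W0 : 0 <= W by rewrite divr_ge0 ?exprn_ge0 ?ltW.
have KW0 : 0 <= K * W `^ m^-1 by rewrite mulr_ge0 ?powR_ge0 ?ltW.
have [e1|e1] := leP 1 e.
  have t1 : 1 <= e `^ m^-1.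
    have mV0 : 0 <= m^-1 by rewrite invr_ge0 ltW.
    by have /= := ge0_ler_powR mV0 ler01 e0 e1; rewrite powR1.
  have [|le1|le1] := h 2^-1 _ (lexx _); first by rewrite invr_gt0.
    rewrite mulrDl; apply: ler_wpDr; first by rewrite mulr_ge0 ?powR_ge0.
    by apply: (le_trans le1); nra.
  rewrite mulrDl; apply: ler_wpDl; first by rewrite mulr_ge0 ?powR_ge0// ltW.
  apply: le_of_powR_le => //; first exact: powR_ge0.
  rewrite -powRrM mulVf ?gt_eqF// powRr1//.
  rewrite exprVn mulrA ler_pdivrMr ?exprn_gt0// -ler_pdivlMr// in le1.
  by rewrite (le_trans le1)// /W le_eqVlt; apply/orP; left; apply/eqP; ring.
(* Here the right side is zero. If [s] were positive, a radius at most [s / (4 * B)] would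
   contradict both alternatives: the first gives [s <= s / 2], the second a positive number below
   zero or equal to it. *)
have [e_0|ene0] := eqVneq e 0.
  rewrite e_0 powR0 ?mulr0; last by rewrite invr_eq0 gt_eqF// ltr_pwDl.
  rewrite leNgt; apply/negP => sp.
  pose r := Num.min 2^-1 (s / (4 * B)).
  have r0 : 0 < r by rewrite lt_min invr_gt0 ltr0n/= divr_gt0 ?mulr_gt0.
  have [|le1|] := h r r0; first by rewrite ge_min lexx.
    have : r <= s / (4 * B) by rewrite ge_min lexx orbT.
    rewrite ler_pdivlMr ?mulr_gt0//; nra.
  by apply/negP; rewrite -ltNge e_0 mulr_gt0 ?powR_gt0 ?divr_gt0 ?mulr_gt0 ?exprn_gt0.
set t := e `^ (m + d%:R)^-1.
have ep : 0 < e by rewrite lt_def ene0.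
have md0 : 0 < m + d%:R by rewrite ltr_pwDl.
have t0 : 0 < t by exact: powR_gt0.
have t1 : t <= 1.
  have mdV : 0 <= (m + d%:R)^-1 by rewrite invr_ge0 ltW.
  by have /= := ge0_ler_powR mdV e0 ler01 (ltW e1); rewrite powR1.
(* The exponent [m + d] is chosen for this splitting: at [r = t / 2] the factor [t ^+ d] cancels
   against the mass of the ball and [t] to the power [m] remains. *)
have eE : e = t `^ m * t ^+ d.
  rewrite -powR_mulrn ?(ltW t0)// -powRD; last by rewrite (gt_eqF t0) implybT.
  by rewrite -powRrM mulVf ?gt_eqF// powRr1.
have [||le1|le1] := h (t / 2); first by rewrite divr_gt0.
- by rewrite ler_piMl ?invr_ge0.
- rewrite mulrDl; apply: ler_wpDr; first by rewrite mulr_ge0// ltW.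
  by apply: (le_trans le1); nra.
- rewrite mulrDl; apply: ler_wpDl; first by rewrite mulr_ge0// ltW.
  apply: le_of_powR_le => //; first exact: ltW.
  have c0 : 0 < q * (t / 2) ^+ d by rewrite mulr_gt0 ?exprn_gt0 ?divr_gt0.
  rewrite -(ler_pM2r c0) (le_trans le1)// [leLHS]eE le_eqVlt /W expr_div_n.
  by apply/orP; left; apply/eqP; field; rewrite expf_neq0// gt_eqF.
Qed.

End averaging.

(** * Optimality, mass and excess for plans of Monge form *)

Section optimal_maps.
Variables (R : realType) (d : nat).
Local Notation X := (borelRd R d).
Implicit Types (rho : {finite_measure set X -> \bar R})
  (pi : {measure set (X * X) -> \bar R}) (c : 'rV[R]_d -> R)
  (T : 'rV[R]_d -> 'rV[R]_d).

Lemma monge_ae_two_point c rho0 rho1 pi T : continuous c ->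
  (forall x, 0 <= c x) -> optimal_plan c rho0 rho1 pi -> monge_form rho0 pi T ->
  {ae rho0, forall x : X, {ae rho0, forall y : X,
    c (x - T x) + c (y - T y) <= c (x - T y) + c (y - T x)}}.
Proof.
move=> cc c0 [cpl fin opt] [mT piE].
have mfst : measurable_fun setT (fst : X * X -> X) := measurable_fst.
have msnd : measurable_fun setT (snd : X * X -> X) := measurable_snd.
pose k (z : X * X) := c ((z.1 : 'rV[R]_d) - z.2).
have mk : measurable_fun setT k.
  apply: (measurableT_comp (continuous_measurable_rV cc)).
  exact: measurable_funB_rV.
have mgr : measurable_fun setT (fun x : X => (x, T x) : X * X).
  by apply: measurable_fun_pair.
have k0 z : 0 <= k z by exact: c0.
have costE : transport_cost c pi = (\int[rho0]_x (k (x, T x))%:E)%E.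
  pose nu : {measure set (X * X) -> \bar R} :=
    pushforward rho0 (fun x : X => (x, T x) : X * X).
  rewrite /transport_cost (eq_measure_integral (nu mgr)); last first.
    by move=> S mS _; exact: piE.
  rewrite ge0_integral_pushforward//; last by move=> z _; rewrite lee_fin k0.
  exact/measurable_EFinP.
apply: (optimal_map_ae_two_point mk k0 mT).
  by rewrite -costE ltey_eq fin.
move=> pi' m1 m2; rewrite -costE; apply: opt => S mS; split; first exact: m1.
(* The second marginal of the plan identifies [rho1 S] with the [rho0]-mass of the preimage of [S]
   under [T]. *)
rewrite m2// -(cpl S mS).2 piE; last by apply: measurableX.
by congr (rho0 _); apply/seteqP; split => x /= => [|[]].
Qed.

Lemma lower_density_eball rho0 (D r : R) (a : 'rV[R]_d) :
  lower_density rho0 = D%:E -> 0 < r -> enorm a + r < 2 ->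
  ((D * r ^+ d)%:E <= rho0 (eball a r : set X))%E.
Proof.
move=> DE r0 ar.
rewrite EFinM -lee_pdivlMr ?exprn_gt0//= -DE; apply: ereal_inf_lbound.
by exists a, r; split => //; exact: compactly_contained_eball.
Qed.

(** Markov's inequality on a ball. *)
Lemma excess_eball_lower rho0 T (A : 'M[R]_d) (b a : 'rV[R]_d) (m t r : R) :
  measurable_fun [set: X] (T : X -> X) -> 0 <= m -> 0 <= t ->
  eball a r `<=` eball 0 2 ->
  {ae rho0, forall y : X, eball a r y ->
     t <= enorm (T y - y - b - (y : 'rV[R]_d) *m A^T)} ->
  ((t `^ m)%:E * rho0 (eball a r : set X) <= excess m rho0 T A b)%E.
Proof.
move=> mT m0 t0 sub ae_t.
have mu : measurable_fun [set: X]
    (fun y : X => enorm (T y - y - b - (y : 'rV[R]_d) *m A^T) `^ m).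
  apply: (measurableT_comp (measurable_powR m)).
  by apply: (measurableT_comp (@measurable_enorm R d)); exact: measurable_displacement.
have mE D' : measurable_fun D' (fun y : X =>
    (enorm (T y - y - b - (y : 'rV[R]_d) *m A^T) `^ m)%:E).
  by apply/measurable_EFinP; exact: measurable_funTS.
have mb a' r' := @measurable_eball R d a' r'.
apply: (@le_trans _ _ (\int[rho0]_(y in (eball a r : set X))
    (enorm (T y - y - b - (y : 'rV[R]_d) *m A^T) `^ m)%:E)%E); last first.
  by apply: ge0_subset_integral => // y _; rewrite lee_fin powR_ge0.
rewrite -integral_cst//; apply: ae_ge0_le_integral => //.
- by move=> y _; rewrite lee_fin powR_ge0.
- by move=> y _; rewrite lee_fin powR_ge0.
apply: filterS ae_t => y ty /ty le_t; rewrite lee_fin.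
by apply: ge0_ler_powR; rewrite ?nnegrE// enorm_ge0.
Qed.

End optimal_maps.

(** * The constants and the pointwise estimate *)

Theorem theorem2 (R : realType) (d : nat) (p m Lambda D normA : R)
    (hp : 1 < p) (hm : 0 < m) (hLambda : 0 < Lambda) (hD : 0 < D) :
  exists C : R, 0 < C /\
  forall (alpha : R) (c : 'rV[R]_d -> R)
    (rho0 rho1 : {finite_measure set (borelRd R d) -> \bar R})
    (pi : {measure set (borelRd R d * borelRd R d) -> \bar R})
    (T : 'rV[R]_d -> 'rV[R]_d) (A : 'M[R]_d) (b : 'rV[R]_d),
  0 < alpha <= 1 ->
  convex_function [set: convex_lmodType 'rV[R]_d] c ->
  C2holder alpha [set x | x != 0] c ->
  C1 c ->
  c 0 = 0 ->
  grad c 0 = 0 ->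
  p_elliptic p Lambda c ->
  rho0 [set: borelRd R d] = rho1 [set: borelRd R d] ->
  optimal_plan c rho0 rho1 pi ->
  monge_form rho0 pi T ->
  lower_density rho0 = D%:E ->
  enorm A = normA ->
  let E := excess m rho0 T A b in
  {ae rho0, forall x : borelRd R d, eball 0 2^-1 x ->
    ((enorm (T x - x - b - (x : 'rV[R]_d) *m A^T))%:E
      <= C%:E * (if 1 <= E then E `^ m^-1 else E `^ (m + d%:R)^-1))%E}.
Proof.
pose k := Lambda ^- 2; have k0 : 0 < k by rewrite invr_gt0 exprn_gt0.
(* The first bound is the opening allowed by the cone estimate; the second helps to keep the
   averaging ball inside [eball 0 2]. *)
pose del := Num.min (k / 2) 2^-1.
have del0 : 0 < del by rewrite lt_min divr_gt0//= invr_gt0.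
have delk : del <= k / 2 by rewrite ge_min lexx.
have del1 : del <= 2^-1 by rewrite ge_min lexx orbT.
pose K := 2 * (1 + k) / k.
have K0 : 0 < K by rewrite divr_gt0// mulr_gt0// ltr_pwDl// ltW.
(* The absolute value makes [B] positive before [normA] is known to be a norm. *)
pose B := K * (1 + `|normA|) * (1 + del).
have B0 : 0 < B.
  by apply: mulr_gt0; [apply: (mulr_gt0 K0)|]; rewrite ltr_pwDl// ltW.
(* A ball of radius [del * r] has mass at least [D * (del * r) ^+ d], that is [q * r ^+ d]. *)
pose q := D * del ^+ d; have q0 : 0 < q by rewrite mulr_gt0 ?exprn_gt0.
pose C := B + 2 * K * (2 ^+ d / q) `^ m^-1.
have C0 : 0 < C.
  by rewrite ltr_wpDr// mulr_ge0 ?powR_ge0// ltW// mulr_gt0.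
exists C; split => // _ c rho0 rho1 pi T A b _ _ _ [dc _] c0 g0 ell _ opt mon ldD nA E.
have cc : continuous c by move=> x; apply: differentiable_continuous; exact: dc.
have cge0 := p_elliptic_ge0 hLambda dc c0 g0 ell.
have E0 : (0 <= E)%E by apply: integral_ge0 => x _; rewrite lee_fin powR_ge0.
apply: filterS (monge_ae_two_point cc cge0 opt mon) => x aex xB.
(* For infinite excess the right side is infinite, as [C] is positive and [m^-1] is nonzero. *)
have [Eoo|Efin] := eqVneq E +oo%E.
  rewrite Eoo leey poweRyr ?invr_eq0 ?gt_eqF// gt0_muley ?leey// lte_fin.
have {}Efin : E \is a fin_num by rewrite ge0_fin_numE// ltey.
pose e := fine E; have Ee : E = e%:E by rewrite fineK.
have e0 : 0 <= e by rewrite fine_ge0.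
rewrite Ee !poweR_EFin lee_fin -[in X in (_ <= _ * X)%E](fun_if EFin) -EFinM lee_fin.
apply: two_regime_bound => //; [exact: enorm_ge0|exact: mulr_gt0|].
move=> r r0 r12.
set u := T x - _ - _ - _.
have [u0|u0] := eqVneq u 0.
  left; have -> : enorm u = 0 by apply/eqP; rewrite enorm_eq0 u0.
  by apply: ltW; apply: mulr_gt0 => //; exact: mulr_gt0.
(* Beyond this threshold the error [B * r] is less than half of [enorm u] and can be absorbed, which
   turns [K] into [2 * K]. *)
have [|lt_u] := leP (enorm u) (2 * B * r); [by left|right].
have un0 : 0 < enorm u by rewrite enorm_gt0.
pose a := x + (r / enorm u) *: u.
have aB : enorm a < 2^-1 + r.
  apply: le_lt_trans (ler_enormD _ _) _.
  move: xB; rewrite /eball/= subr0 => xB.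
  rewrite enormZ ger0_norm; last by rewrite ltW ?divr_gt0.
  by rewrite divfK ?gt_eqF// ltrD2r.
have dr0 : 0 < del * r by rewrite mulr_gt0.
(* The centre has norm below [2^-1 + r], at most 1, and [del * r] is at most a quarter. *)
have adr : enorm a + del * r < 2 by nra.
have sub : eball a (del * r) `<=` eball 0 2.
  move=> y; rewrite /eball/= subr0 => ya.
  have -> : y = (y - a) + a by rewrite subrK.
  by apply: le_lt_trans (ler_enormD _ _) _; lra.
have t0 : 0 <= enorm u / (2 * K).
  by apply: divr_ge0; [exact: enorm_ge0|apply: ltW; exact: mulr_gt0].
have aet : {ae rho0, forall y : borelRd R d, eball a (del * r) y ->
    enorm u / (2 * K) <= enorm (T y - y - b - (y : 'rV[R]_d) *m A^T)}.
  apply: filterS aex => y le2 ya.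
  have yE : y = x + (r / enorm u) *: u + (y - a) by rewrite addrC subrK.
  have := displacement_le (A := A) (b := b) hLambda dc ell le2 del0 delk r0 u0 yE (ltW ya).
  rewrite -/k -/K nA => le_u.
  have nB : K * ((1 + normA) * ((1 + del) * r)) = B * r.
    by rewrite /B ger0_norm -?nA ?enorm_ge0//; ring.
  rewrite mulrDr nB in le_u; rewrite ler_pdivrMr; last exact: mulr_gt0.
  move: le_u lt_u; move: (enorm _) (enorm _) => U V; clearbody B K; lra.
have := excess_eball_lower mon.1 (ltW hm) t0 sub aet.
rewrite -/E Ee => le_e; rewrite -lee_fin; apply: le_trans le_e.
rewrite EFinM lee_wpmul2l ?lee_fin ?powR_ge0// /q -mulrA -exprMn.
exact: lower_density_eball.
Qed.
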